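(* Fix an instant $k$ and consider the certainty equivalence control problem $$(P_{CE})\qquad \min_{u(k)}\ J_{CE}(k)\Big|_{\bm w(k)=\hat{\bm w}(k)},\qquad J_{CE}(k)=E\left\{[y(k+1)-y_r(k+1)]^2\mid I_k\right\},$$ subject to $y(k+1)=\bm x^T(k)\bm w(k)$, where $\bm x(k)=[u(k),\bm\eta^T(k)]^T$, and where the unknown parameter vector $\bm w(k)=[b_1(k),\ldots,b_m(k),a_1(k),\ldots,a_n(k)]^T$ is set equal to its current estimate $\hat{\bm w}(k)=[\hat b_1(k),\hat{\bm\alpha}^T(k)]^T$ with $\hat b_1(k)\neq 0$. Then the certainty equivalence control law, i.e. the solution of $(P_{CE})$, is $$u_{CE}(k)=\frac{y_r(k+1)-\bm\eta^T(k)\hat{\bm\alpha}(k)}{\hat b_1(k)},$$ where $\hat{\bm\alpha}(k)=[\hat b_2(k),\ldots,\hat b_m(k),\hat a_1(k),\ldots,\hat a_n(k)]^T$ and $\bm\eta(k)=[u(k-1),\ldots,u(k-m+1),z(k),\ldots,z(k-n+1)]^T$.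
   Context: The system is single-input single-output with known orders $m,n$: $y(k+1)=b_1(k)u(k)+\cdots+b_m(k)u(k-m+1)+a_1(k)y(k)+\cdots+a_n(k)y(k-n+1)$, measured through $z(k)=y(k)+e(k)$ with $e(k)$ asymmetric Laplace measurement noise, i.e. with density $\frac{\tau(1-\tau)}{\delta}e^{-(1-\tau)|x-\mu|/\delta}$ for $x<\mu$ and $\frac{\tau(1-\tau)}{\delta}e^{-\tau|x-\mu|/\delta}$ for $x\ge\mu$ (with $0<\tau<1$, $\delta>0$). The paper writes this system in regression form as $y(k+1)=\bm x^T(k)\bm w(k)$ with the measured regressor $\bm x(k)=[u(k),\ldots,u(k-m+1),z(k),\ldots,z(k-n+1)]^T$. Here $y_r(k+1)$ is the given reference value, and $I_k$ is the information available at time $k$; the past inputs, the measurements $z(k),\ldots,z(k-n+1)$, and the estimate $\hat{\bm w}(k)$ are known given $I_k$. Certainty equivalence means that, in deriving the control law at instant $k$, the estimate $\hat{\bm w}(k)$ is treated as the true (known, deterministic) value of $\bm w(k)$; the minimization is over the real number $u(k)$. *)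

(* Defs.v *)
From HB Require Import structures.
From mathcomp Require Import all_boot all_order all_algebra.
From mathcomp Require Import all_classical all_reals all_analysis.
From mathcomp Require Import measurable_realfun.

Set Implicit Arguments.
Unset Strict Implicit.
Unset Printing Implicit Defensive.
Import Order.TTheory GRing.Theory Num.Theory.
Import numFieldNormedType.Exports.
Local Open Scope classical_set_scope.
Local Open Scope ring_scope.

Definition ald_pdf (R : realType) (tau delta mu x : R) : R :=
  if x < mu
  then tau * (1 - tau) / delta * expR (- ((1 - tau) * `|x - mu| / delta))
  else tau * (1 - tau) / delta * expR (- (tau * `|x - mu| / delta)).

Definition has_ald_law d (T : measurableType d) (R : realType)
    (P : probability T R) (tau delta mu : R) (X : {RV P >-> R}) : Prop :=
  forall A : set R, measurable A ->
    distribution P X A =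
    (\int[lebesgue_measure]_(x in A) (ald_pdf tau delta mu x)%:E)%E.

(* [u(k-1), ..., u(k-m+1), z(k), ..., z(k-n+1)]^T at the sample point t. The
   instants are integers, so that k - i needs no truncation. *)
Definition past_data (T : Type) (R : realType) (m n : nat) (u z : int -> T -> R)
    (k : int) (t : T) : 'cV[R]_(m.-1 + n) :=
  col_mx (\col_(i < m.-1) u (k - i.+1%:Z) t) (\col_(j < n) z (k - j%:Z) t).
Arguments past_data {T R} m n u z k t.

(* For m > 0, the parameter vector [b_1, ..., b_m, a_1, ..., a_n]^T has type
   'cV_(1 + (m.-1 + n)): its upper block is b_1, its lower block is
   [b_2, ..., b_m, a_1, ..., a_n]^T. *)
Definition lead_gain (R : realType) (p : nat) (w : 'cV[R]_(1 + p)) : R :=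
  usubmx w 0 0.

Definition other_params (R : realType) (p : nat) (w : 'cV[R]_(1 + p)) :
    'cV[R]_p :=
  dsubmx w.

Definition regressor (R : realType) (p : nat) (v : R) (h : 'cV[R]_p) :
    'cV[R]_(1 + p) :=
  col_mx v%:M h.

Definition model_output (R : realType) (p : nat) (x w : 'cV[R]_p) : R :=
  (x^T *m w) 0 0.

(* I is the sigma-algebra of the available information. *)
Definition known d (T : measurableType d) d' (S : measurableType d')
    (I : set (set T)) (f : T -> S) : Prop :=
  measurable_fun [set: g_sigma_algebraType I] (f : g_sigma_algebraType I -> S).

(* Z is a version of E[X | I], for X measurable with values in [0, +oo]; for
   such X no integrability is needed. *)
Definition is_cond_exp d (T : measurableType d) (R : realType)
    (P : probability T R) (I : set (set T)) (X Z : T -> \bar R) : Prop :=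
  [/\ known I Z,
      forall t, (0 <= Z t)%E &
      forall A, I A -> (\int[P]_(t in A) Z t = \int[P]_(t in A) X t)%E].

(* J v is a version of E[(y(k+1) - r)^2 | I] when u(k) = v and
   y(k+1) = [v, h^T] w. A conditional expectation is only defined up to a
   P-null set which may depend on v; to minimize over the real number v at a
   given sample point, the versions are chosen continuous in v. *)
Definition is_JCE d (T : measurableType d) (R : realType)
    (P : probability T R) (I : set (set T)) (p : nat)
    (h : T -> 'cV[R]_p) (r : R) (w : T -> 'cV[R]_(1 + p))
    (J : R -> T -> \bar R) : Prop :=
  (forall v : R, is_cond_exp P I
     (fun t => ((model_output (regressor v (h t)) (w t) - r) ^+ 2)%:E) (J v)) /\
  (forall t : T, continuous (fun v : R => J v t)).

Definition is_argmin (R : realType) (f : R -> \bar R) (v : R) : Prop :=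
  forall v' : R, (f v <= f v')%E.

(* us is the (almost surely unique) solution of the problem of minimizing the
   cost over the real number u(k), given the information I; the first conjunct
   says that the cost is well defined. *)
Definition is_the_solution d (T : measurableType d) (R : realType)
    (P : probability T R) (I : set (set T)) (p : nat)
    (h : T -> 'cV[R]_p) (r : R) (w : T -> 'cV[R]_(1 + p))
    (us : T -> R) : Prop :=
  (exists J, is_JCE P I h r w J) /\
  (forall J, is_JCE P I h r w J ->
     {ae P, forall t, forall v : R, is_argmin (J ^~ t) v <-> v = us t}).

(* Main.v *)
Require Import Defs.
From HB Require Import structures.
From mathcomp Require Import all_boot all_order all_algebra.
From mathcomp Require Import all_classical all_reals all_analysis.
From mathcomp Require Import measurable_realfun.

(** Once the estimate replaces the unknown parameters, nothing in the predicted
    output is random given the available information: the regressor consists of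
    past inputs and measurements, which are known, and of the candidate input
    v. Hence the squared error X v = (v b + c - r)^2, with b the estimated lead
    gain and c the contribution of the past data, is its own conditional
    expectation, and minimizing the cost is minimizing a square that vanishes
    exactly at v = (r - c) / b when b is nonzero.

    The measure-theoretic content lies in the word version. The cost is an
    arbitrary family J of versions of the conditional expectations, and for
    each v the version J v agrees with X v only off a null set that depends on
    v. Almost sure uniqueness is [cond_exp_known_ae]; as X v may fail to be
    integrable, it is proved on the sublevel sets of X v, on which the
    integrals are finite. Taking the union of the null sets over rational v
    and using that J and X are continuous in v
    ([continuous_eq_on_dense]) gives one null set off which J and X agree for
    all real v, so that there [argmin_affine_sq] applies to J itself. *)

Set Implicit Arguments.
Unset Strict Implicit.
Import Order.TTheory GRing.Theory Num.Theory.
Import numFieldNormedType.Exports.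
Local Open Scope classical_set_scope.
Local Open Scope ring_scope.

Lemma continuous_eq_on_dense (X Y : topologicalType) (D : set X) (f g : X -> Y) :
  hausdorff_space Y -> dense D -> continuous f -> continuous g ->
  {in D, f =1 g} -> f =1 g.
Proof.
move=> hY dD cf cg fg x; apply: hY => A B fxA gxB.
have : nbhs x (f @^-1` A `&` g @^-1` B).
  by apply: filterI; [exact: cf | exact: cg].
rewrite nbhsE => -[V [oV Vx] sV].
have [z [Vz Dz]] := dD V (ex_intro _ x Vx) oV.
have [Afz Bgz] := sV z Vz.
by exists (f z); split=> //; rewrite /= ?fg ?inE.
Qed.

(** Over A, the integral of the positive function g - f is 0; finiteness of the
    integral of f is what allows this subtraction. *)
Lemma ae_notin_lt_eq_integral d (T : measurableType d) (R : realType)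
    (mu : {measure set T -> \bar R}) (A : set T) (f g : T -> \bar R) :
  measurable A -> measurable_fun A f -> measurable_fun A g ->
  (forall t, A t -> 0 <= f t < g t)%E ->
  (\int[mu]_(t in A) f t < +oo)%E ->
  (\int[mu]_(t in A) g t = \int[mu]_(t in A) f t)%E ->
  {ae mu, forall t, ~ A t}.
Proof.
move=> mA mf mg fg fi gf.
have f0 t : A t -> (0 <= f t)%E by move=> /fg/andP[].
have g0 t : A t -> (0 <= g t)%E.
  by move=> /fg/andP[? /ltW]; exact: le_trans.
have intf : mu.-integrable A f.
  apply/integrableP; split=> //.
  by under eq_integral => t /set_mem At do rewrite gee0_abs ?f0//.
have intg : mu.-integrable A g.
  apply/integrableP; split=> //.
  by under eq_integral => t /set_mem At do rewrite gee0_abs ?g0//; rewrite gf.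
have : (\int[mu]_(t in A) `|(g \- f)%E t| = 0)%E.
  rewrite (eq_integral (g \- f)%E); last first.
    move=> t /set_mem /fg /andP[_ fgt].
    by rewrite gee0_abs// ltW// sube_gt0.
  rewrite integralB// gf subee//.
  by rewrite ge0_fin_numE ?integral_ge0.
move/(ae_eq_integral_abs mu mA (emeasurable_funB mg mf)).
apply: filterS => t /= gf0 At.
have /andP[_] := fg t At.
by rewrite -sube_gt0 gf0// ltxx.
Qed.

Lemma known_measurable d (T : measurableType d) d' (S : measurableType d')
    (I : set (set T)) (f : T -> S) :
  sigma_algebra [set: T] I -> I `<=` measurable ->
  known I f -> measurable_fun [set: T] f.
Proof.
move=> sI subI kf _ B mB; apply: subI.
by rewrite -(sigma_algebra_id sI); exact: kf.
Qed.

(** The sets {X < Z} and {Z < X} belong to the sigma-algebra, so X and Z have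
    the same integral over each of them. Cutting by {X <= n} makes these
    integrals finite, hence the cut sets are null; they exhaust {X <> Z}
    because X is finite everywhere. *)
Lemma cond_exp_known_ae d (T : measurableType d) (R : realType)
    (P : probability T R) (I : set (set T)) (X : T -> R) (Z : T -> \bar R) :
  sigma_algebra [set: T] I -> I `<=` measurable ->
  known I X -> (forall t, 0 <= X t) ->
  is_cond_exp P I (EFin \o X) Z ->
  {ae P, forall t, Z t = (X t)%:E}.
Proof.
move=> sI subI kX X0 [kZ Z0 ZX].
have kEX : known I (EFin \o X) by exact/measurable_EFinP.
have mX := known_measurable sI subI kX.
have mEX := known_measurable sI subI kEX.
have mZ := known_measurable sI subI kZ.
have II A : measurable (A : set (g_sigma_algebraType I)) -> I A.
  by move=> mA; rewrite -(sigma_algebra_id sI).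
pose E n := [set t | (X t)%:E <= (n%:R)%:E]%E : set T.
have kE n : measurable (E n : set (g_sigma_algebraType I)).
  rewrite -[E n]setTI.
  exact: (emeasurable_fun_infty_c measurableT kEX (n%:R)%:E).
pose A n := E n `&` [set t | ((X t)%:E < Z t)%E].
pose B n := E n `&` [set t | (Z t < (X t)%:E)%E].
have kA n : I (A n).
  apply: II; apply: measurableI => //.
  by rewrite -[X in measurable X]setTI; apply: measurable_lte.
have kB n : I (B n).
  apply: II; apply: measurableI => //.
  by rewrite -[X in measurable X]setTI; apply: measurable_lte.
have fin n C : C `<=` E n -> I C -> (\int[P]_(t in C) (X t)%:E < +oo)%E.
  move=> CE IC.
  apply: (@le_lt_trans _ _ (\int[P]_(t in C) (n%:R)%:E)%E).
    apply: ge0_le_integral => //; first exact: subI.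
    - by move=> t _; rewrite lee_fin.
    - exact: measurable_funTS.
  rewrite integral_cst ?lte_mul_pinfty ?lee_fin//; last exact: subI.
  apply: le_lt_trans (probability_le1 P _) _; [exact: subI | exact: ltry].
have aeA n : {ae P, forall t, ~ A n t}.
  apply: (ae_notin_lt_eq_integral (f := EFin \o X) (g := Z)).
  - exact: subI.
  - exact: measurable_funTS.
  - exact: measurable_funTS.
  - by move=> t [_ /= ->]; rewrite lee_fin X0.
  - by apply: (fin n) => // t [].
  - exact: ZX.
have aeB n : {ae P, forall t, ~ B n t}.
  apply: (ae_notin_lt_eq_integral (f := Z) (g := EFin \o X)).
  - exact: subI.
  - exact: measurable_funTS.
  - exact: measurable_funTS.
  - by move=> t [_ /= ->]; rewrite Z0.
  - by rewrite ZX//; apply: (fin n) => // t [].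
  - by rewrite ZX.
have aeAB n : {ae P, forall t, ~ A n t /\ ~ B n t}.
  by apply: filterS2 (aeA n) (aeB n) => t.
apply: filterS (ae_foralln aeAB) => t nAB.
have [nA nB] := nAB (Num.truncn (X t)).+1.
have Et : E (Num.truncn (X t)).+1 t.
  by rewrite /E /= lee_fin ltW// truncnS_gt.
by case: (ltgtP (Z t) (X t)%:E) => // ltZX; [case: nB | case: nA].
Qed.

Lemma model_output_regressor (R : realType) (p : nat) (v : R) (h : 'cV[R]_p)
    (w : 'cV[R]_(1 + p)) :
  model_output (regressor v h) w
  = v * lead_gain w + (h^T *m other_params w) 0 0.
Proof.
rewrite /model_output /regressor -{1}(vsubmxK w) tr_col_mx mul_row_col.
by rewrite mxE tr_scalar_mx mul_scalar_mx mxE.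
Qed.

Lemma argmin_affine_sq (R : realType) (b c r v : R) : b != 0 ->
  is_argmin (fun v => ((v * b + c - r) ^+ 2)%:E) v <-> v = (r - c) / b.
Proof.
move=> b0; split=> [vmin|-> v'].
  have := vmin ((r - c) / b); rewrite lee_fin divfK// subrK subrr expr0n/=.
  rewrite le_eqVlt ltNge sqr_ge0 orbF sqrf_eq0 => /eqP h.
  rewrite -[v](mulfK b0); congr (_ / _); apply/eqP.
  by rewrite -subr_eq0 opprB addrA h.
by rewrite lee_fin divfK// subrK subrr expr0n/= sqr_ge0.
Qed.

Lemma known_regression d (T : measurableType d) (R : realType)
    (I : set (set T)) (p : nat) (h : T -> 'cV[R]_p) (w : T -> 'cV[R]_p) :
  (forall i, known I (fun t => h t i 0)) ->
  (forall i, known I (fun t => w t i 0)) ->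
  known I (fun t => ((h t)^T *m w t) 0 0).
Proof.
move=> kh kw; rewrite /known.
under eq_fun do rewrite mxE.
apply: measurable_sum => i.
under eq_fun do rewrite mxE.
exact: measurable_funM (kh i) (kw i).
Qed.

Lemma known_past_data d (T : measurableType d) (R : realType)
    (I : set (set T)) (m n : nat) (k : int) (u z : int -> T -> R) :
  (forall j : int, j < k -> known I (u j)) ->
  (forall j : nat, (j < n)%N -> known I (z (k - j%:Z))) ->
  forall i, known I (fun t => past_data m n u z k t i 0).
Proof.
move=> ku kz i; rewrite /known.
under eq_fun do rewrite mxE.
case: (fintype.split i) => j; under eq_fun do rewrite mxE.
  by apply: ku; rewrite ltrBlDr ltrDl.
exact: kz.
Qed.

Lemma known_model_output d (T : measurableType d) (R : realType)
    (I : set (set T)) (p : nat) (v : R) (h : T -> 'cV[R]_p)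
    (w : T -> 'cV[R]_(1 + p)) :
  (forall i, known I (fun t => h t i 0)) ->
  (forall i, known I (fun t => w t i 0)) ->
  known I (fun t => model_output (regressor v (h t)) (w t)).
Proof.
move=> kh kw; apply: known_regression => // i; rewrite /known.
under eq_fun do rewrite mxE.
case: (fintype.split i) => j; last exact: kh.
by under eq_fun do rewrite mxE; exact: measurable_cst.
Qed.

Unset Implicit Arguments.
Set Strict Implicit.

Theorem theorem2 (d : measure_display) (T : measurableType d) (R : realType)
    (P : probability T R) (m n : nat) (m_gt0 : (0 < m)%N)
    (tau delta mu : R) (tau01 : 0 < tau < 1) (delta_gt0 : 0 < delta)
    (k : int)
    (* inputs, outputs, measurement noise, measurements *)
    (u y e z : int -> {RV P >-> R})
    (* unknown parameter vectors w(j) *)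
    (w : int -> T -> 'cV[R]_(1 + (m.-1 + n)))
    (* the plant up to time k; y(k+1) is governed by the constraint of the
       control problem *)
    (plant : forall (j : int) (t : T), j < k ->
       y (j + 1) t = model_output (regressor (u j t) (past_data m n u y j t)) (w j t))
    (measurement : forall (j : int) (t : T), z j t = y j t + e j t)
    (noise : forall j : int, has_ald_law tau delta mu (e j))
    (* reference values *)
    (yr : int -> R)
    (* information available at time k *)
    (I : set (set T)) (I_sigma : sigma_algebra [set: T] I)
    (I_sub : I `<=` measurable)
    (u_known : forall j : int, j < k -> known I (u j))
    (z_known : forall j : nat, (j < n)%N -> known I (z (k - j%:Z)))
    (* estimate of w(k) *)
    (what : T -> 'cV[R]_(1 + (m.-1 + n)))
    (what_known : forall i, known I (fun t => what t i 0))
    (what_lead : {ae P, forall t, lead_gain (what t) != 0}) :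
  is_the_solution P I (past_data m n u z k) (yr (k + 1)) what
    (fun t => (yr (k + 1)
               - ((past_data m n u z k t)^T *m other_params (what t)) 0 0)
              / lead_gain (what t)).
Proof.
set h := past_data m n u z k; set r := yr (k + 1).
have kh : forall i, known I (fun t => h t i 0).
  by apply: (known_past_data (u := u) (z := z)).
pose c t := ((h t)^T *m other_params (what t)) 0 0.
pose f v t := (model_output (regressor v (h t)) (what t) - r) ^+ 2.
have fE v t : f v t = (v * lead_gain (what t) + c t - r) ^+ 2.
  by rewrite /f model_output_regressor.
have kf v : known I (f v).
  by apply: measurable_funX; apply: measurable_funB => //;
    exact: known_model_output.
have f0 v t : 0 <= f v t by rewrite sqr_ge0.
have cf t : continuous (fun v => (f v t)%:E).
  move=> v; apply: cvg_EFin; first exact: nearW.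
  under eq_fun do rewrite /= fE.
  rewrite /= fE expr2; under eq_fun do rewrite expr2.
  apply: cvgM; (apply: cvgB; last exact: cvg_cst);
    (apply: cvgD; last exact: cvg_cst);
    by apply: cvgM; [exact: cvg_id | exact: cvg_cst].
split.
  exists (fun v t => (f v t)%:E); split=> // v; split=> //.
  - by have /measurable_EFinP := kf v.
  - by move=> t; rewrite lee_fin.
move=> J [Jcond Jcont].
have Jf q : {ae P, forall t, J (ratr q) t = (f (ratr q) t)%:E}.
  exact: (cond_exp_known_ae I_sigma I_sub (kf _) (f0 _) (Jcond _)).
have : {ae P, forall t, forall q : rat, J (ratr q) t = (f (ratr q) t)%:E}.
  (* The rationals are enumerated by unpickle to use countable additivity. *)
  have aeJ i : {ae P, forall t, if unpickle i is Some q
      then J (ratr q) t = (f (ratr q) t)%:E else True}.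
    by case: unpickle => [q|]; [exact: Jf | exact: aeW].
  apply: filterS (ae_foralln aeJ) => t Jt q.
  by have := Jt (pickle q); rewrite pickleK.
apply: filterS2 what_lead => t b0 Jft v.
have -> : J ^~ t = fun v => ((v * lead_gain (what t) + c t - r) ^+ 2)%:E.
  apply/funext => v'; rewrite -fE.
  apply: (@continuous_eq_on_dense R (\bar R) _ (J ^~ t)
    (fun v => (f v t)%:E) _ (@dense_rat R)) => //.
  by move=> _ /set_mem[q _ <-].
exact: argmin_affine_sq.
Qed.
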